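(* Let $\mathbf g=(g_1,\dots,g_s)$ and suppose that the Krull dimension of $\mathbb R[\mathbf X]/\operatorname{supp}\mathcal Q(\mathbf g)$ is $0$. Then $S=\mathcal S(\mathbf g)=\{\xi_1,\dots,\xi_r\}$ is non-empty and finite, and, with $\rho=\rho(\xi_1,\dots,\xi_r)$, there exists $d\in\mathbb N$ such that for all $k\in\mathbb N$: $$\mathcal L_{d+k}(\mathbf g)^{[2(\rho-1)+k]}=\operatorname{cone}(\mathbf e_{\xi_1},\dots,\mathbf e_{\xi_r})^{[2(\rho-1)+k]}.$$
   Context: $\mathbb R[\mathbf X]=\mathbb R[X_1,\dots,X_n]$, $\mathbb R[\mathbf X]_t$ polynomials of degree $\le t$; $\Sigma^2$ sums of squares, $\Sigma^2_t=\Sigma^2\cap\mathbb R[\mathbf X]_t$. $\mathcal Q_t(\mathbf g)=\{s_0+\sum_j s_jg_j: s_0\in\Sigma^2_t, s_j\in\Sigma^2,\deg s_j\le t-\deg g_j\}$, $\mathcal Q(\mathbf g)=\bigcup_t\mathcal Q_t(\mathbf g)$, $\operatorname{supp}Q=Q\cap(-Q)$. $\mathcal L_t(\mathbf g)=\{\sigma\in(\mathbb R[\mathbf X]_t)^*:\sigma(q)\ge 0\ \forall q\in\mathcal Q_t(\mathbf g)\}$. $\mathcal S(\mathbf g)=\{x\in\mathbb R^n:g_j(x)\ge0\ \forall j\}$. $\mathbf e_\xi$ is evaluation at $\xi$; $\sigma^{[t]}$ denotes restriction of a functional to $\mathbb R[\mathbf X]_t$ and $B^{[t]}=\{\sigma^{[t]}:\sigma\in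 B\}$; $\operatorname{cone}$ denotes the generated convex cone. For a finite set $\Xi\subset\mathbb R^n$, $\rho(\Xi)$ is the Castelnuovo–Mumford regularity of its vanishing ideal $\mathcal I(\Xi)$; it is a standard fact that $\mathcal I(\Xi)$ has a graded basis of degree $\le\rho(\Xi)$ and that there are interpolation polynomials $u_i$ ($u_i(\xi_j)=\delta_{ij}$) of degree $\le\rho(\Xi)-1$. *)

(* Defs.v *)
From HB Require Import structures.
From mathcomp Require Import all_boot all_order all_algebra.
From mathcomp Require Import reals.
From mathcomp Require Import mpoly.

Set Implicit Arguments.
Unset Strict Implicit.
Unset Printing Implicit Defensive.

Import Order.TTheory GRing.Theory Num.Theory.
Local Open Scope ring_scope.

Section Defs.
Variables (R : realType) (n : nat).
Local Notation P := {mpoly R[n]}.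

(* total degree; deg 0 is taken to be 0 (msize 0 = 0) *)
Definition mdeg_tot (p : P) : nat := (msize p).-1.

Definition deg_le (t : nat) (p : P) : Prop := (msize p <= t.+1)%N.

Definition is_sos (p : P) : Prop :=
  exists qs : seq P, p = \sum_(q <- qs) q ^+ 2.

Definition is_sos_t (t : nat) (p : P) : Prop := is_sos p /\ deg_le t p.

Definition QM_t (s : nat) (g : 'I_s -> P) (t : nat) (p : P) : Prop :=
  exists (s0 : P) (sj : 'I_s -> P),
    is_sos_t t s0 /\
    (forall j, is_sos (sj j) /\
       (sj j = 0 \/ (mdeg_tot (sj j) + mdeg_tot (g j) <= t)%N)) /\
    p = s0 + \sum_(j < s) sj j * g j.

Definition QM (s : nat) (g : 'I_s -> P) (p : P) : Prop :=
  exists t, QM_t g t p.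

Definition supp_QM (s : nat) (g : 'I_s -> P) (p : P) : Prop :=
  QM g p /\ QM g (- p).

Definition is_ideal (I : P -> Prop) : Prop :=
  I 0 /\ (forall a b, I a -> I b -> I (a + b)) /\
  (forall a b, I b -> I (a * b)).

Definition is_prime_ideal (I : P -> Prop) : Prop :=
  is_ideal I /\ ~ I 1 /\ (forall a b, I (a * b) -> I a \/ I b).

Definition subpred (I J : P -> Prop) : Prop := forall p, I p -> J p.

(* Krull dimension of R[X]/J equals 0: via the correspondence between prime
   ideals of R[X]/J and prime ideals of R[X] containing J, there is a chain of
   primes of length 0 (a prime) but none of length 1. *)
Definition krull_dim_quot_eq0 (J : P -> Prop) : Prop :=
  (exists Pr, is_prime_ideal Pr /\ subpred J Pr) /\
  (forall P1 P2, is_prime_ideal P1 -> is_prime_ideal P2 ->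
     subpred J P1 -> subpred P1 P2 -> subpred P2 P1).

Definition semialg (s : nat) (g : 'I_s -> P) (x : 'I_n -> R) : Prop :=
  forall j, 0 <= (g j).@[x].

Definition interp_deg (r : nat) (xi : 'I_r -> 'I_n -> R) (t : nat) : Prop :=
  forall c : 'I_r -> R, exists p : P, deg_le t p /\ forall i, p.@[xi i] = c i.

(* Castelnuovo-Mumford regularity rho of the vanishing ideal of a finite set
   of points: rho = 1 + (least t such that the evaluation map
   R[X]_t -> R^Xi is surjective), i.e. 1 + index of regularity of the
   Hilbert function.  is_regularity xi rho holds iff rho = rho(Xi). *)
Definition is_regularity (r : nat) (xi : 'I_r -> 'I_n -> R) (rho : nat) : Prop :=
  (0 < rho)%N /\ interp_deg xi rho.-1 /\
  (forall t, interp_deg xi t -> (rho.-1 <= t)%N).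

(* L_t(g): functionals on R[X]_t (represented by functions on R[X] of which
   only the values on R[X]_t matter), linear on R[X]_t, nonnegative on Q_t(g) *)
Definition in_L (s : nat) (g : 'I_s -> P) (t : nat) (sigma : P -> R) : Prop :=
  (forall (a : R) (p q : P), deg_le t p -> deg_le t q ->
      sigma (a *: p + q) = a * sigma p + sigma q) /\
  (forall q, QM_t g t q -> 0 <= sigma q).

Definition in_cone_eval (r : nat) (xi : 'I_r -> 'I_n -> R) (tau : P -> R) : Prop :=
  exists lam : 'I_r -> R, (forall i, 0 <= lam i) /\
    forall p, tau p = \sum_(i < r) lam i * p.@[xi i].

Definition restr_eq (m : nat) (A B : (P -> R) -> Prop) : Prop :=
  (forall sigma, A sigma -> exists tau, B tau /\
       forall p, deg_le m p -> sigma p = tau p) /\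
  (forall tau, B tau -> exists sigma, A sigma /\
       forall p, deg_le m p -> sigma p = tau p).

End Defs.

(* Main.v *)
(* Let J = supp Q(g). Dimension 0 means that every a satisfies a^N (1 - a b) in J for
   some N and b; as R is uncountable and R[X] has countable dimension, each variable
   is then algebraic modulo J, so S(g) is finite. Enlarging a proper quadratic module
   one variable at a time produces a real point where it is nonnegative; applied to
   the localisation of Q(g) at a polynomial h vanishing on S(g), this puts a power of
   h in J. By Cauchy-Schwarz, functionals in L_t(g) with t large then kill the
   monomial multiples of h, with a loss of degree depending only on h. Interpolation
   polynomials u_i provide finitely many such h, namely 1 - sum_i u_i and
   (X_l - xi_il) u_i, which suffice to reduce every polynomial p to
   sum_i p(xi_i) u_i without raising the degree of the multipliers above deg p; and
   sigma(u_i) = sigma(u_i^2) >= 0. *)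
Require Import Defs.
From HB Require Import structures.
From mathcomp Require Import all_boot all_order all_algebra.
From mathcomp Require Import reals.
From mathcomp Require Import mpoly.
From mathcomp Require Import ring lra zify.
From mathcomp Require Import complex.
From mathcomp Require boolp classical_sets.

Set Implicit Arguments.
Unset Strict Implicit.
Unset Printing Implicit Defensive.

Import Order.TTheory GRing.Theory Num.Theory.
Local Open Scope ring_scope.

(** * Prime ideals and Krull dimension zero *)

Section PrimeIdeals.
Variables (R : realType) (n : nat).
Local Notation P := {mpoly R[n]}.
Implicit Types (a b c : P) (I J M : P -> Prop).

Lemma is_ideal_adjoin J a :
  is_ideal J -> is_ideal (fun p => exists c b, J c /\ p = c + b * a).
Proof.
move=> [J0 [JD JM]]; split; first by exists 0, 0; rewrite mul0r addr0.
split=> [p q [c [b [Jc ->]]] [c' [b' [Jc' ->]]]|p q [c [b [Jc ->]]]].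
  by exists (c + c'), (b + b'); split; [exact: JD | ring].
by exists (p * c), (p * b); split; [exact: JM | ring].
Qed.

(** Zorn's lemma gives an ideal [I] maximal among those containing [J] and disjoint from [M]. If a
    and b lie outside [I], then I + (a) and I + (b) both meet [M]; the product of the two witnesses
    lies in I + (ab), so ab is outside [I] as well. *)
Lemma exists_prime_ideal_avoiding J M :
  is_ideal J -> M 1 -> (forall a b, M a -> M b -> M (a * b)) ->
  (forall a, J a -> ~ M a) ->
  exists I, is_prime_ideal I /\ Defs.subpred J I /\ (forall a, I a -> ~ M a).
Proof.
move=> idJ M1 MM JM; have [J0 [JD JMl]] := idJ.
(* adding J to every set makes the empty chain harmless *)
pose good (X : P -> Prop) := is_ideal (fun p => J p \/ X p)
  /\ forall p, J p \/ X p -> ~ M p.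
have [X [[idX XM] maxX]] : exists X, good X /\
    forall Y, (classical_sets.proper X Y) -> ~ good Y.
  apply: (@classical_sets.Zorn_bigcup P good) => F Fgood Ftot.
  split; last first.
    move=> p [/JM //|[X FX Xp]]; have [_] := Fgood _ FX; apply; by right.
  have Jsub : forall p, J p -> J p \/
      classical_sets.bigcup F id p by left.
  split; first by left.
  split=> [a b [Ja|[X FX Xa]] [Jb|[Y FY Yb]]|a b [Jb|[Y FY Yb]]].
  - by left; apply: JD.
  - have [[_ [HD _]] _] := Fgood _ FY.
    by case: (HD a b (or_introl Ja) (or_intror Yb)); [left|right; exists Y].
  - have [[_ [HD _]] _] := Fgood _ FX.
    by case: (HD a b (or_intror Xa) (or_introl Jb)); [left|right; exists X].
  - case: (Ftot _ _ FX FY) => sXY.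
      have [[_ [HD _]] _] := Fgood _ FY.
      by case: (HD a b (or_intror (sXY _ Xa)) (or_intror Yb));
        [left|right; exists Y].
    have [[_ [HD _]] _] := Fgood _ FX.
    by case: (HD a b (or_intror Xa) (or_intror (sXY _ Yb)));
      [left|right; exists X].
  - by left; apply: JMl.
  - have [[_ [_ HM]] _] := Fgood _ FY.
    by case: (HM a b (or_intror Yb)); [left|right; exists Y].
set I := fun p => J p \/ X p in idX XM; exists I.
have [_ [ID IM]] := idX.
have meetM a : ~ I a -> exists c b, I c /\ M (c + b * a).
  move=> nIa; apply: boolp.contrapT => nex.
  pose Y := fun p => exists c b, I c /\ p = c + b * a.
  have Ia c : I c -> Y c by move=> Ic; exists c, 0; rewrite mul0r addr0.
  have Ya : Y a.
    by exists 0, 1; split; [left | rewrite mul1r add0r].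
  apply: (maxX Y).
    split=> [p Xp|sYX]; first by apply: Ia; right.
    by apply: nIa; right; apply: sYX.
  have JY p : (J p \/ Y p) <-> Y p.
    by split=> [[Jp|//]|]; [apply: Ia; left|right].
  split; last first.
    by move=> p /JY [c [b [Ic ->]]] Mp; apply: nex; exists c, b.
  have [Y0 [YD YM]] := is_ideal_adjoin a idX.
  split; first by right.
  by split=> [p q /JY Yp /JY Yq|p q /JY Yq]; right; [exact: YD | exact: YM].
split; last by split=> [p Jp|//]; left.
split=> //; split=> [/XM //|a b Iab].
apply: boolp.contrapT => /boolp.not_orP [/meetM [c [u [Ic Mc]]] /meetM [d [v [Id Md]]]].
apply: (XM _ _ (MM _ _ Mc Md)).
have -> : (c + u * a) * (d + v * b) = (d + v * b) * c + ((u * a) * d + (u * v) * (a * b)).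
  by ring.
exact: (ID _ _ (IM _ _ Ic) (ID _ _ (IM _ _ Id) (IM _ _ Iab))).
Qed.

(** Otherwise some prime [I1] containing [J] avoids all a^N (1 - a b). Then 1 is not in I1 + (a), so
    a prime [I2] contains I1 + (a), and dimension 0 forces a into [I1]; but a has the avoided form
    with N = 1 and b = 0. *)
Lemma krull_dim0_strongly_regular J :
  is_ideal J -> krull_dim_quot_eq0 J ->
  forall a, exists N b, J (a ^+ N * (1 - a * b)).
Proof.
move=> idJ [_ dim0] a; apply: boolp.contrapT => nex.
have [||||I1 [pI1 [JI1 I1M]]] := @exists_prime_ideal_avoiding J
    (fun p => exists N b, p = a ^+ N * (1 - a * b)) => //.
- by exists 0%N, 0; rewrite mulr0 subr0 mulr1.
- move=> _ _ [N [b ->]] [N' [b' ->]].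
  by exists (N + N')%N, (b + b' - a * b * b'); rewrite exprD; ring.
- by move=> p Jp [N [b eN]]; apply: nex; exists N, b; rewrite -eN.
have idI1 := pI1.1; have [I0 [ID IM]] := idI1.
have [||||I2 [pI2 [sI2 I2M]]] := @exists_prime_ideal_avoiding
    (fun p => exists c b, I1 c /\ p = c + b * a) (fun p => p = 1).
- exact: is_ideal_adjoin.
- by [].
- by move=> _ _ -> ->; rewrite mulr1.
- move=> _ [c [b [Ic ->]]] e1; apply: (I1M c Ic); exists 0%N, b.
  by rewrite expr0 mul1r -e1; ring.
have sI12 : Defs.subpred I1 I2.
  by move=> p Ip; apply: sI2; exists p, 0; rewrite mul0r addr0.
have I1a : I1 a.
  apply: (dim0 I1 I2) => //; apply: sI2.
  by exists 0, 1; rewrite add0r mul1r.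
by apply: (I1M a I1a); exists 1%N, 0; rewrite mulr0 subr0 mulr1 expr1.
Qed.

End PrimeIdeals.

(** * Quadratic modules, their supports and localisations *)

Section QuadraticModules.
Variables (R : realType) (n : nat).
Local Notation P := {mpoly R[n]}.
Implicit Types (a b c p : P) (Q : P -> Prop).

Definition quad_module Q :=
  [/\ Q 1, forall a b, Q a -> Q b -> Q (a + b) & forall a b, Q b -> Q (a ^+ 2 * b)].

Definition supp_qm Q p := Q p /\ Q (- p).

Lemma quad_module0 Q : quad_module Q -> Q 0.
Proof. by case=> Q1 _ QS; rewrite -(mul0r (1 : P)) -{1}(mul0r (0 : P)) -expr2; apply: QS. Qed.

Lemma quad_module_sqr Q a : quad_module Q -> Q (a ^+ 2).
Proof. by case=> Q1 _ QS; rewrite -[_ ^+ 2]mulr1; apply: QS. Qed.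

(** The identity a b = ((a + 1)/2)^2 b - ((a - 1)/2)^2 b expresses multiplication by an arbitrary a
    through squares, since both b and -b are available. *)
Lemma is_ideal_supp_qm Q : quad_module Q -> is_ideal (supp_qm Q).
Proof.
move=> qQ; have [Q1 QD QS] := qQ.
split; first by split; rewrite ?oppr0; apply: quad_module0.
split=> [a b [Qa Qa'] [Qb Qb']|a b [Qb Qb']].
  by split; rewrite ?opprD; apply: QD.
have h2 : (2^-1)%:MP * 2%:R = 1 :> P.
  by rewrite -mpolyC_nat -mpolyCM mulVf ?pnatr_eq0 // mpolyC1.
set h : P := (2^-1)%:MP in h2.
have E : a * b = (h * (a + 1)) ^+ 2 * b + (h * (a - 1)) ^+ 2 * (- b).
  transitivity ((h * 2%:R) ^+ 2 * (a * b)); first by rewrite h2; ring.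
  by ring.
have E' : - (a * b) = (h * (a + 1)) ^+ 2 * (- b) + (h * (a - 1)) ^+ 2 * b.
  by rewrite E; ring.
by split; rewrite ?E' ?E; apply: QD; apply: QS.
Qed.

Lemma quad_moduleZ Q (c : R) p : quad_module Q -> 0 <= c -> Q p -> Q (c *: p).
Proof.
move=> [_ _ QS] c0 Qp; rewrite -(sqr_sqrtr c0) -mul_mpolyC rmorphXn.
exact: QS.
Qed.

(** The localisation of [Q] at [h]. Only even powers occur, so raising [N] multiplies by a square
    and stays in [Q]. *)
Definition colon_qm Q (h : P) p := exists N, Q (h ^+ (2 * N) * p).

Lemma quad_module_colon1 Q w :
  quad_module Q -> quad_module (fun p => Q (w ^+ 2 * p)).
Proof.
move=> [Q1 QD QS]; split=> [|a b Qa Qb|a b Qb]; first exact: QS.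
  by rewrite mulrDr; apply: QD.
by rewrite mulrCA; apply: QS.
Qed.

Lemma quad_module_colon Q h : quad_module Q -> quad_module (colon_qm Q h).
Proof.
move=> qQ; have [Q1 QD QS] := qQ.
have up a N N' : (N <= N')%N -> Q (h ^+ (2 * N) * a) -> Q (h ^+ (2 * N') * a).
  move=> /subnKC <- Qa; rewrite mulnDr addnC exprD -mulrA mulnC exprM.
  exact: QS.
split=> [|a b [N Na] [N' Nb]|a b [N Nb]].
- by exists 0%N; rewrite muln0 mul1r.
- exists (maxn N N'); rewrite mulrDr.
  by apply: QD; [apply: up Na|apply: up Nb]; rewrite ?leq_maxl ?leq_maxr.
- by exists N; rewrite mulrCA; apply: QS.
Qed.

(* If -1 = q + x with x = w b, then -q = 1 + x and x^2 lies in the support, so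
   (1 - x/2)^2 q is congruent to -1 and brings -1 into Q. *)
Lemma adjoin_nilpotent_proper Q w : quad_module Q -> ~ Q (-1) -> supp_qm Q (w ^+ 2) ->
  [/\ quad_module (fun p => exists q b, Q q /\ p = q + b * w),
      ~ (exists q b, Q q /\ -1 = q + b * w) &
      supp_qm (fun p => exists q b, Q q /\ p = q + b * w) w].
Proof.
move=> qQ nQ sw; have [Q1 QD QS] := qQ; have Q0 := quad_module0 qQ.
have [S0 [SD SM]] := is_ideal_supp_qm qQ.
split.
- split; first by exists 1, 0; rewrite mul0r addr0.
    move=> _ _ [q [b [Qq ->]]] [q' [b' [Qq' ->]]].
    by exists (q + q'), (b + b'); split; [exact: QD | ring].
  move=> a _ [q [b [Qq ->]]].
  by exists (a ^+ 2 * q), (a ^+ 2 * b); split; [exact: QS | ring].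
- move=> [q [b [Qq e1]]]; apply: nQ.
  have h2 : (2^-1)%:MP * 2%:R = 1 :> P.
    by rewrite -mpolyC_nat -mpolyCM mulVf ?pnatr_eq0 // mpolyC1.
  set h : P := (2^-1)%:MP in h2.
  set x := b * w in e1.
  have qE : q = - (1 + x) by rewrite opprD e1; ring.
  have -> : -1 = (1 - h * x) ^+ 2 * q + (h ^+ 2 * b ^+ 2 * (x - 3)) * w ^+ 2.
    rewrite qE /x.
    transitivity (-1 - (1 - h * 2%:R) * (b * w - h * 2%:R * (b * w) ^+ 2)).
      by rewrite h2; ring.
    by ring.
  by apply: QD; [exact: QS | have [] := SM (h ^+ 2 * b ^+ 2 * (x - 3)) _ sw].
- split; first by exists 0, 1; rewrite add0r mul1r.
  by exists 0, (-1); rewrite add0r mulN1r.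
Qed.

End QuadraticModules.

(** * Univariate relations and real points of proper quadratic modules *)

Lemma mnm_ind (n : nat) (T : 'X_{1..n} -> Prop) :
  T 0%MM -> (forall i m, T m -> T (U_(i) + m)%MM) -> forall m, T m.
Proof.
move=> T0 TS m; have [k] := ubnP (mdeg m); elim: k m => // k IH m mk.
have [->//|m0] := eqVneq m 0%MM.
have [i mi] : exists i, (U_(i) <= m)%MM.
  have [/existsP [i mi]|nex] := boolP [exists i, m i != 0%N].
    by exists i; rewrite lep1mP.
  case/eqP: m0; apply/mnmP => i; rewrite mnm0E.
  by apply/eqP; apply: contraNT nex => mi; apply/existsP; exists i.
rewrite -(submK mi) addmC; apply: TS; apply: IH.
by have := congr1 mdeg (submK mi); rewrite mdegD mdeg1 => mE; lia.
Qed.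

Section UnivariateRelations.
Variables (R : realType) (n : nat).
Local Notation P := {mpoly R[n]}.
Implicit Types (Q : P -> Prop) (x w : P) (f u : {poly R}).

Local Notation "f .<[ x ]" := (horner_alg x f) (at level 2, format "f .<[ x ]").

(** A complex root b + ic of [f] yields the factor X - b if c = 0, and the real quadratic (X - b)^2
    + c^2 otherwise. *)
Lemma real_poly_factor f : (1 < size f)%N ->
  exists u w : {poly R}, [/\ f = u * w, (size w < size f)%N, w != 0 &
    (exists b, u = 'X - b%:P) \/
    (exists b c, c != 0 /\ u = ('X - b%:P) ^+ 2 + (c ^+ 2)%:P)].
Proof.
move=> sf; have f0 : f != 0 by rewrite -size_poly_gt0 ltnW.
have [z rz] : exists z : complex R, root (map_poly (real_complex R) f) z.
  by apply/closed_rootP; rewrite size_map_poly neq_ltn sf orbT.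
have fin u : (1 < size u)%N -> u %| f -> exists w : {poly R},
    [/\ f = u * w, (size w < size f)%N & w != 0].
  move=> su /dvdpP [w fE]; have w0 : w != 0.
    by apply: contraNneq f0 => w0; rewrite fE w0 mul0r.
  have u0 : u != 0 by rewrite -size_poly_gt0 ltnW.
  exists w; split=> //; first by rewrite mulrC.
  rewrite fE size_mul // -subn1 -addnBA ?(ltnW su) //.
  by rewrite -[X in (X < _)%N]addn0 ltn_add2l subn_gt0.
case: z rz => b c; have [->|c0] := eqVneq c 0 => rz.
  have rb : root f b by move: rz; rewrite -[complex.Complex b 0]/(real_complex R b) fmorph_root.
  have [||w [fE sw w0]] := fin ('X - b%:P); rewrite ?size_XsubC ?dvdp_XsubCl //.
  by exists ('X - b%:P), w; split=> //; left; exists b.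
set u := ('X - b%:P) ^+ 2 + (c ^+ 2)%:P.
have su : size u = 3%N.
  rewrite size_polyDl ?size_exp_XsubC // (leq_ltn_trans (size_polyC_leq1 _)) //.
have uz : root (map_poly (real_complex R) u) (complex.Complex b c).
  rewrite /root rmorphD rmorphXn rmorphB /= map_polyX !map_polyC /= !hornerE.
  rewrite expr2 complex.eq_complex /=; apply/andP; split; apply/eqP; ring.
have [||w [fE sw w0]] := fin u; first by rewrite su.
  have u0 : u != 0 by rewrite -size_poly_gt0 su.
  have : root (map_poly (real_complex R) (modp f u)) (complex.Complex b c).
    move: rz; rewrite {1}(divp_eq f u) rmorphD rmorphM rootE hornerD hornerM.
    by rewrite (eqP uz) mulr0 add0r.
  have : (size (modp f u) <= 2)%N by rewrite -ltnS -su ltn_modp.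
  (* A real remainder of degree at most 1 vanishing at the nonreal point b + ic is zero: the
     imaginary part gives r_1 c = 0. *)
  move=> sr; rewrite /dvdp; set r := modp f u in sr *.
  have -> : r = r`_1 *: 'X + (r`_0)%:P.
    apply/polyP => i; rewrite coefD coefZ coefX coefC.
    by case: i => [|[|i]] /=; rewrite ?mulr1 ?mulr0 ?add0r ?addr0 // nth_default // (leq_trans sr).
  rewrite rootE rmorphD /= map_polyZ map_polyX map_polyC !hornerE complex.eq_complex /=.
  rewrite mul0r !addr0 => /andP [/eqP Er /eqP Ei].
  have r1 : r`_1 = 0.
    have : r`_1 * c = 0 by rewrite -[RHS]Ei; ring.
    by move/eqP; rewrite mulf_eq0 (negPf c0) orbF => /eqP.
  have r0 : r`_0 = 0 by rewrite -[RHS]Er r1; ring.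
  by rewrite r1 r0 scale0r add0r.
by exists u, w; split=> //; right; exists b, c.
Qed.

(* Write f = u w with u irreducible. If {p | w^2 p in Q} is proper, its support
   contains u(x), which excludes u = (T - b)^2 + c^2. Otherwise w(x)^2 lies in the
   support of Q, so w(x) may be adjoined, and w has smaller degree than f. *)
Lemma proper_qm_real_value Q x f : quad_module Q -> ~ Q (-1) ->
  f != 0 -> supp_qm Q f.<[x] ->
  exists (a : R) (Q' : P -> Prop), [/\ quad_module Q', ~ Q' (-1),
    Defs.subpred Q Q' & supp_qm Q' (x - a%:MP)].
Proof.
have [m] := ubnP (size f); elim: m Q f => // m IH Q f sf qQ nQ f0 sQf.
have [Q1 QD QS] := qQ; have [S0 [SD SM]] := is_ideal_supp_qm qQ.
have [sf1|sf1] := leqP (size f) 1.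
  have fE := size1_polyC sf1; rewrite fE in sQf f0.
  rewrite polyC_eq0 in f0.
  have [_ Qn1] : supp_qm Q 1.
    have := SM ((f`_0)^-1)%:MP _ sQf.
    by rewrite horner_algC alg_mpolyC -mpolyCM mulVf // mpolyC1.
  by case: nQ.
have [u [w [fE sw w0 uE]]] := real_poly_factor sf1.
have [Qw|nQw] := boolp.pselect (Q (w.<[x] ^+ 2 * (-1))).
  have sw2 : supp_qm Q (w.<[x] ^+ 2).
    split; first exact: quad_module_sqr.
    by rewrite mulrN1 in Qw.
  have [qQ' nQ' sQ'] := adjoin_nilpotent_proper qQ nQ sw2.
  have [|a [Q' [qQ2 nQ2 sub sa]]] := IH _ w _ qQ' nQ' w0 sQ'; first lia.
  exists a, Q'; split=> // p Qp; apply: sub; exists p, 0.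
  by rewrite mul0r addr0.
have qQw := quad_module_colon1 w.<[x] qQ.
have su : supp_qm (fun p => Q (w.<[x] ^+ 2 * p)) u.<[x].
  have := SM w.<[x] _ sQf; rewrite fE rmorphM /=.
  by rewrite /supp_qm mulrN [_ * (_ * _)]mulrCA -expr2 mulrC.
have subw : Defs.subpred Q (fun p => Q (w.<[x] ^+ 2 * p)) by move=> p; apply: QS.
case: uE => [[b uE]|[b [c [c0 uE]]]].
  exists b, (fun p => Q (w.<[x] ^+ 2 * p)); split=> //.
  by move: su; rewrite uE rmorphB /= horner_algX horner_algC alg_mpolyC.
case: nQw.
have [_ Du _] := qQw.
(* As u(x) is in the support, -c^2 = (x - b)^2 - u(x) lies in {p | w(x)^2 p in Q}; rescaling by
   c^(-2) gives -1. *)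
have : Q (w.<[x] ^+ 2 * (- (c ^+ 2)%:MP)).
  have -> : - (c ^+ 2)%:MP = - u.<[x] + (x - b%:MP) ^+ 2.
    have -> : u.<[x] = (x - b%:MP) ^+ 2 + (c ^+ 2)%:MP.
      rewrite uE rmorphD /= horner_algC alg_mpolyC; congr (_ + _).
      by rewrite rmorphXn rmorphB /= horner_algX horner_algC alg_mpolyC.
    by rewrite opprD addrAC addNr add0r.
  by apply: Du; [case: su | apply: (quad_module_sqr _ qQw)].
move=> Qc; have := quad_moduleZ qQ (sqr_ge0 c^-1) Qc.
by rewrite -mul_mpolyC mulrCA mulrN -mpolyCM -exprMn mulVf // expr1n mpolyC1.
Qed.

(** The relations survive each enlargement of the module, so the X_i - v_i enter the support one
    after the other. Modulo the final support p equals the constant p(v), and a negative constant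
    would rescale to -1. *)
Lemma proper_qm_point Q : quad_module Q -> ~ Q (-1) ->
  (forall i : 'I_n, exists2 f, f != 0 & supp_qm Q f.<['X_i]) ->
  exists v : 'I_n -> R, forall p, Q p -> 0 <= p.@[v].
Proof.
move=> qQ nQ alg.
have [v [Q' [qQ' nQ' sub sv]]] : exists (v : 'I_n -> R) Q', [/\ quad_module Q',
    ~ Q' (-1), Defs.subpred Q Q' & forall i : 'I_n, supp_qm Q' ('X_i - (v i)%:MP)].
  suff H k : (k <= n)%N -> exists (v : 'I_n -> R) Q', [/\ quad_module Q',
    ~ Q' (-1), Defs.subpred Q Q' &
    forall i : 'I_n, (i < k)%N -> supp_qm Q' ('X_i - (v i)%:MP)].
    have [v [Q' [q1 q2 q3 q4]]] := H n (leqnn n).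
    by exists v, Q'; split=> // i; apply: q4.
  elim: k => [|k IH] kn; first by exists (fun _ => 0), Q; split.
  have [v [Q1 [q1 q2 q3 q4]]] := IH (ltnW kn).
  have [f f0 [fa fb]] := alg (Ordinal kn).
  have [|a [Q2 [r1 r2 r3 r4]]] := proper_qm_real_value q1 q2 f0 (x := 'X_(Ordinal kn)).
    by split; apply: q3.
  exists (fun i : 'I_n => if (i < k)%N then v i else a), Q2; split=> //.
    by move=> p /q3; apply: r3.
  move=> i; rewrite ltnS leq_eqVlt => /orP [/eqP ik|ik].
    have -> : i = Ordinal kn by apply: val_inj.
    by rewrite /= ltnn.
  by rewrite ik; have [? ?] := q4 i ik; split; apply: r3.
have [S0 [SD SM]] := is_ideal_supp_qm qQ'.
have SB p q : supp_qm Q' p -> supp_qm Q' q -> supp_qm Q' (p - q).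
  by move=> sp sq; rewrite -mulN1r; apply: SD => //; apply: SM.
have ev p : supp_qm Q' (p - (p.@[v])%:MP).
  have SX m : supp_qm Q' ('X_[m] - ('X_[m].@[v])%:MP).
    elim/mnm_ind: m => [|i m Hm]; first by rewrite mpolyX0 meval1 mpolyC1 subrr.
    rewrite mpolyXD mevalM mevalXU mpolyCM.
    have -> : 'X_i * 'X_[m] - (v i)%:MP * ('X_[m].@[v])%:MP =
      'X_[m] * ('X_i - (v i)%:MP) + (v i)%:MP * ('X_[m] - ('X_[m].@[v])%:MP) :> P.
      by ring.
    by apply: SD; apply: SM.
  elim/mpolyind: p => [|c m p _ _ IH]; first by rewrite meval0 mpolyC0 subrr.
  rewrite mevalD mevalZ mpolyCD mpolyCM opprD addrACA; apply: SD => //.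
  by rewrite -mul_mpolyC -mulrBr; apply: SM.
exists v => p /sub Qp; rewrite leNgt; apply/negP => pv.
have [_ QD _] := qQ'; apply: nQ'.
have Qc : Q' (p.@[v])%:MP.
  have -> : (p.@[v])%:MP = p + - (p - (p.@[v])%:MP) by ring.
  by apply: QD => //; case: (ev p).
have : 0 <= - (p.@[v])^-1 by rewrite oppr_ge0 invr_le0 ltW.
move=> /(quad_moduleZ qQ')/(_ Qc); rewrite -mul_mpolyC -mpolyCM mulNr mulVf ?lt_eqF //.
by rewrite mpolyCN mpolyC1.
Qed.

End UnivariateRelations.

(** * Uncountability of the reals *)

Section Uncountability.
Variable R : realType.

Lemma subitv_avoiding (s : seq R) (a b : R) : a < b ->
  exists a' b', [/\ a <= a', a' < b', b' <= b & forall x, x \in s -> ~~ (a' <= x <= b')].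
Proof.
elim: s => [|x s IH] in a b *; first by exists a, b.
move=> /IH [a' [b' [aa ab bb sP]]].
(* The kept interval misses [x]: the last quarter if [x] is at most the midpoint, the left half
   otherwise. *)
have [xm|xm] := leP x ((a' + b') / 2).
  exists ((a' + 3 * b') / 4), b'; split=> //; try lra.
  move=> y; rewrite inE => /predU1P [->|/sP]; first lra.
  lra.
exists a', ((a' + b') / 2); split=> //; try lra.
move=> y; rewrite inE => /predU1P [->|/sP]; first lra.
lra.
Qed.

(** Cantor's nested intervals: [I k.+1] avoids the points of [s k], and the supremum of the left
    endpoints lies in every interval. *)
Lemma exists_notin_seqs (s : nat -> seq R) : exists c, forall k, c \notin s k.
Proof.
have /boolp.choice [f fP] : forall kp : nat * (R * R), exists q : R * R,
    kp.2.1 < kp.2.2 -> [/\ kp.2.1 <= q.1, q.1 < q.2, q.2 <= kp.2.2 &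
       forall x, x \in s kp.1 -> ~~ (q.1 <= x <= q.2)].
  move=> [k [a b]] /=; have [ab|ab] := ltP a b; last by exists (0, 0).
  by have [a' [b' ?]] := subitv_avoiding (s k) ab; exists (a', b').
pose I := fix I k : R * R := if k is k'.+1 then f (k', I k') else (0, 1).
have Ilt k : (I k).1 < (I k).2.
  by elim: k => [|k IH] /=; [exact: ltr01 | have [] := fP (k, I k) IH].
have Istep k : [/\ (I k).1 <= (I k.+1).1, (I k.+1).2 <= (I k).2 &
       forall x, x \in s k -> ~~ ((I k.+1).1 <= x <= (I k.+1).2)].
  by have [] := fP (k, I k) (Ilt k).
have Imono j k : (j <= k)%N -> (I j).1 <= (I k).1 /\ (I k).2 <= (I j).2.
  elim: k => [|k IH]; first by rewrite leqn0 => /eqP ->.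
  rewrite leq_eqVlt => /predU1P [->//|/IH [h1 h2]].
  by have [h3 h4 _] := Istep k; split; [exact: le_trans h3 | exact: le_trans h2].
have Icross j k : (I j).1 <= (I k).2.
  have [/Imono [h _]|/ltnW /Imono [_ h]] := leqP j k.
    by rewrite (le_trans h) // ltW.
  by rewrite (le_trans _ h) // ltW.
pose E : R -> Prop := fun x => exists k, x = (I k).1.
have supE : classical_sets.has_sup E.
  split; first by exists (I 0%N).1, 0%N.
  by exists 1 => _ [k ->]; apply: (Icross k 0%N).
exists (sup E) => k; apply/negP => sk.
have [_ _ /(_ _ sk)/negP] := Istep k; apply; apply/andP; split.
  by apply: sup_upper_bound => //; exists k.+1.
by apply: ge_sup; [case: supE | move=> _ [j ->]; apply: Icross].
Qed.

(** Induction on the bound: either a duplicate-free list in [E] attains size [K] and so exhausts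
    [E], or the bound drops by one. *)
Lemma bounded_card_seq (T : eqType) (E : T -> Prop) (K : nat) :
  (forall s, uniq s -> (forall c, c \in s -> E c) -> (size s < K)%N) ->
  exists t : seq T, forall c, E c -> c \in t.
Proof.
elim: K => [|K IH] H; first by have : (size (Nil T) < 0)%N by apply: H.
have [[s [us sE sK]]|nex] := boolp.pselect (exists s : seq T,
    [/\ uniq s, forall c, c \in s -> E c & size s = K]).
  exists s => c Ec; apply/negPn/negP => cs.
  have : (size (c :: s) < K.+1)%N.
    apply: H => [|d]; first by rewrite /= cs.
    by rewrite inE => /predU1P [->|/sE].
  by rewrite /= sK ltnn.
apply: IH => s us sE; rewrite ltn_neqAle -ltnS H // andbT.
by apply/eqP => sK; apply: nex; exists s.
Qed.

End Uncountability.

(** * Algebraicity of polynomials modulo an ideal *)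

Section Algebraicity.
Variables (R : realType) (n : nat).
Local Notation P := {mpoly R[n]}.
Local Notation "f .<[ x ]" := (horner_alg x f) (at level 2, format "f .<[ x ]").

Lemma ideal_sum (J : P -> Prop) (I : Type) (r : seq I) (F : I -> P) :
  is_ideal J -> (forall i, J (F i)) -> J (\sum_(i <- r) F i).
Proof. by move=> [J0 [JD _]] JF; elim/big_ind: _. Qed.

(** Row i of [A] lists the coefficients of b_i at the monomials of degree below [D]; with more rows
    than columns, [A] has a nonzero left kernel vector. *)
Lemma mpoly_linear_dependence (m D : nat) (b : 'I_m -> P) :
  (#|{: 'X_{1..n < D}}| < m)%N -> (forall i, (msize (b i) <= D)%N) ->
  exists2 v : 'I_m -> R, exists i, v i != 0 & \sum_i v i *: b i = 0.
Proof.
set M := #|_| => Mm bD.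
pose A := \matrix_(i < m, j < M) (b i)@_(enum_val j : 'X_{1..n < D}).
have : kermx A != 0.
  by rewrite -mxrank_eq0 mxrank_ker subn_eq0 -ltnNge (leq_ltn_trans _ Mm) ?rank_leq_col.
move=> /rowV0Pn [v /sub_kermxP vA /rV0Pn [i vi]].
exists (fun i => v 0 i); first by exists i.
apply/mpolyP => k; rewrite mcoeff0 raddf_sum /=.
have [kD|kD] := ltnP (mdeg k) D.
  have := congr1 (fun B : 'rV_M => B 0 (enum_rank (BMultinom kD))) vA.
  rewrite !mxE => vE; rewrite -[RHS]vE; apply: eq_bigr => j _.
  by rewrite mcoeffZ mxE enum_rankK.
rewrite big1 // => j _; rewrite mcoeffZ memN_msupp_eq0 ?mulr0 //.
by apply: msize_mdeg_ge; apply: leq_trans kD.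
Qed.

(* The resolvents b_c of x - c, c ranging over the uncountable R, cannot be
   linearly independent in a space of countable dimension, and a linear relation
   among them is a univariate relation for x. *)
Lemma exists_univariate_relation (J : P -> Prop) : is_ideal J ->
  (forall a, exists N b, J (a ^+ N * (1 - a * b))) ->
  forall x : P, exists2 f : {poly R}, f != 0 & J f.<[x].
Proof.
move=> idJ reg x; have [J0 [JD JM]] := idJ.
have /boolp.choice [Nb NbP] : forall c : R, exists Nb : nat * P,
    J ((x - c%:MP) ^+ Nb.1 * (1 - (x - c%:MP) * Nb.2)).
  by move=> c; have [N [b Jb]] := reg (x - c%:MP); exists (N, b).
pose M D := #|{: 'X_{1..n < D}}|.
(* Otherwise, for each [D], only finitely many c have a b_c of size at most [D], and these countably
   many finite sets would cover the reals. *)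
have [D [s [us sD ss]]] : exists D (s : seq R),
    [/\ uniq s, forall c, c \in s -> (msize (Nb c).2 <= D)%N & (M D < size s)%N].
  apply: boolp.contrapT => nex.
  have /boolp.choice [t tP] : forall D, exists t : seq R,
      forall c, (msize (Nb c).2 <= D)%N -> c \in t.
    move=> D; apply: (@bounded_card_seq _ _ (M D).+1) => s us sD.
    by rewrite ltnS leqNgt; apply/negP => ?; apply: nex; exists D, s.
  have [c cP] := exists_notin_seqs t.
  by have := cP (msize (Nb c).2); rewrite tP.
pose c (i : 'I_(size s)) := s`_i.
have cI i j : i != j -> c i - c j != 0.
  by move=> ij; rewrite subr_eq0 /c nth_uniq.
have [||v [i0 vi0] vb] := @mpoly_linear_dependence (size s) D (fun i => (Nb (c i)).2).
- exact: ss.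
- by move=> i; apply: sD; apply: mem_nth.
(* [f0] supplies the powers (x - c_j)^(N_j); [f1] is the numerator of sum_i v_i / (X - c_i), nonzero
   because only the term of [i0] survives at c_(i0). *)
pose f0 : {poly R} := \prod_j ('X - (c j)%:P) ^+ (Nb (c j)).1.
pose f1 : {poly R} := \sum_i v i *: \prod_(j | j != i) ('X - (c j)%:P).
have f1n0 : f1 != 0.
  apply/eqP => /(congr1 (fun p : {poly R} => p.[c i0])).
  rewrite horner0 horner_sum (bigD1 i0) //= [X in _ + X]big1 ?addr0 => [|k ki]; last first.
    by rewrite hornerZ horner_prod (bigD1 i0) 1?eq_sym //= hornerXsubC subrr mul0r mulr0.
  rewrite hornerZ horner_prod => /eqP; rewrite mulf_eq0 (negPf vi0) /=.
  apply/negP; apply/prodf_neq0 => j ji; rewrite hornerXsubC; apply: cI.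
  by rewrite eq_sym.
exists (f0 * f1).
  rewrite mulf_neq0 //; apply/prodf_neq0 => j _.
  by rewrite expf_neq0 // polyXsubC_eq0.
pose y j := x - (c j)%:MP.
have yE j : ('X - (c j)%:P).<[x] = y j.
  by rewrite rmorphB /= horner_algX horner_algC alg_mpolyC.
have -> : (f0 * f1).<[x] = \sum_i
    (v i)%:MP * (\prod_(j | j != i) (y j ^+ (Nb (c j)).1 * y j)) *
     (y i ^+ (Nb (c i)).1 * (1 - y i * (Nb (c i)).2)).
  transitivity (\sum_i (v i)%:MP * ((\prod_j y j ^+ (Nb (c j)).1)
      * (\prod_(j | j != i) y j)) * (1 - y i * (Nb (c i)).2)); last first.
    apply: eq_bigr => i _; rewrite big_split /= (bigD1 i) //=; ring.
  (* Subtracting the vanishing term prod_j y_j * sum_i v_i b_i produces the factors 1 - y_i b_i. *)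
  transitivity ((\prod_j y j ^+ (Nb (c j)).1) *
     ((\sum_i (v i)%:MP * \prod_(j | j != i) y j)
       - (\prod_j y j) * \sum_i v i *: (Nb (c i)).2)).
    rewrite vb mulr0 subr0 rmorphM /=; congr (_ * _).
      by rewrite rmorph_prod; apply: eq_bigr => j _; rewrite rmorphXn /= yE.
    rewrite rmorph_sum; apply: eq_bigr => i _; rewrite -mul_polyC rmorphM /= horner_algC alg_mpolyC rmorph_prod; congr (_ * _).
    by apply: eq_bigr => j _; apply: yE.
  rewrite [(\prod_j y j) * _]mulr_sumr -sumrB mulr_sumr; apply: eq_bigr => i _.
  by rewrite -mul_mpolyC (bigD1 i (P := xpredT) (F := y)) //=; ring.
by apply: ideal_sum => // i; apply: JM; apply: NbP.
Qed.

End Algebraicity.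

(** * Degree bounds and truncated quadratic modules *)

Section TruncatedModules.
Variables (R : realType) (n : nat).
Local Notation P := {mpoly R[n]}.
Implicit Types (p q h : P).

Lemma deg_le_trans a b p : (a <= b)%N -> deg_le a p -> deg_le b p.
Proof. by rewrite /deg_le => ab /leq_trans; apply. Qed.

Lemma deg_le0 a : deg_le a (0 : P).
Proof. by rewrite /deg_le msize0. Qed.

Lemma deg_leD a p q : deg_le a p -> deg_le a q -> deg_le a (p + q).
Proof.
by rewrite /deg_le => pa qa; apply: leq_trans (msizeD_le _ _) _; rewrite geq_max pa.
Qed.

Lemma deg_leZ a (c : R) p : deg_le a p -> deg_le a (c *: p).
Proof. by rewrite /deg_le => pa; apply: leq_trans (msizeZ_le _ _) _. Qed.

Lemma deg_leN a p : deg_le a p -> deg_le a (- p).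
Proof. by rewrite -scaleN1r; apply: deg_leZ. Qed.

Lemma deg_leM a b p q : deg_le a p -> deg_le b q -> deg_le (a + b) (p * q).
Proof.
rewrite /deg_le => pa qb.
have [->|p0] := eqVneq p 0; first by rewrite mul0r msize0.
have [->|q0] := eqVneq q 0; first by rewrite mulr0 msize0.
rewrite msizeM //; move: pa qb; move: (msize p) (msize q) => x y; lia.
Qed.

Lemma deg_leX a k p : deg_le a p -> deg_le (a * k) (p ^+ k).
Proof.
move=> pa; elim: k => [|k IH]; first by rewrite /deg_le muln0 msize1.
by rewrite exprS mulnS; apply: deg_leM.
Qed.

Lemma deg_le_sum a (I : Type) (r : seq I) (F : I -> P) :
  (forall i, deg_le a (F i)) -> deg_le a (\sum_(i <- r) F i).
Proof. by move=> Fa; elim/big_ind: _ => // [|p q]; [exact: deg_le0 | exact: deg_leD]. Qed.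

Lemma deg_le_mnm (m : 'X_{1..n}) : deg_le (mdeg m) ('X_[m] : P).
Proof. by rewrite /deg_le msizeX. Qed.

Lemma deg_le_msize p : deg_le (msize p) p.
Proof. by rewrite /deg_le. Qed.

Lemma is_sosD p q : is_sos p -> is_sos q -> is_sos (p + q).
Proof. by move=> [s ->] [t ->]; exists (s ++ t); rewrite big_cat. Qed.

Lemma is_sos_sqrM p q : is_sos q -> is_sos (p ^+ 2 * q).
Proof.
move=> [s ->]; exists [seq p * x | x <- s]; rewrite big_map mulr_sumr.
by apply: eq_bigr => x _; rewrite exprMn.
Qed.

Lemma is_sos_sqr p : is_sos (p ^+ 2).
Proof. by exists [:: p]; rewrite big_seq1. Qed.

Lemma is_sos0 : is_sos (0 : P).
Proof. by exists [::]; rewrite big_nil. Qed.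

Lemma is_sos_meval_ge0 p (x : 'I_n -> R) : is_sos p -> 0 <= p.@[x].
Proof.
move=> [s ->]; rewrite raddf_sum /=; apply: sumr_ge0 => q _.
by rewrite rmorphXn /= sqr_ge0.
Qed.

Variables (s : nat) (g : 'I_s -> P).

Lemma QMP p : QM g p <-> exists (s0 : P) (sj : 'I_s -> P),
  [/\ is_sos s0, forall j, is_sos (sj j) & p = s0 + \sum_(j < s) sj j * g j].
Proof.
split=> [[t [s0 [sj [[sos0 _] [sosj ->]]]]]|[s0 [sj [sos0 sosj ->]]]].
  by exists s0, sj; split=> // j; case: (sosj j).
exists (msize s0 + \sum_j (mdeg_tot (sj j) + mdeg_tot (g j)))%N, s0, sj.
split; first by split=> //; apply: deg_le_trans (deg_le_msize s0); rewrite leq_addr.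
split=> // j; split=> //; right; rewrite (bigD1 j) //=; lia.
Qed.

Lemma quad_module_QM : quad_module (QM g).
Proof.
split.
- apply/QMP; exists 1, (fun _ => 0); split.
  + by rewrite -(expr1n P 2); apply: is_sos_sqr.
  + by move=> _; apply: is_sos0.
  + by rewrite big1 ?addr0 // => j _; rewrite mul0r.
- move=> a b /QMP [s0 [sj [h0 hj ->]]] /QMP [t0 [tj [k0 kj ->]]].
  apply/QMP; exists (s0 + t0), (fun j => sj j + tj j); split.
  + exact: is_sosD.
  + by move=> j; apply: is_sosD.
  + rewrite addrACA -big_split; congr (_ + _).
    by apply: eq_bigr => j _; rewrite mulrDl.
- move=> a b /QMP [s0 [sj [h0 hj ->]]].
  apply/QMP; exists (a ^+ 2 * s0), (fun j => a ^+ 2 * sj j); split.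
  + exact: is_sos_sqrM.
  + by move=> j; apply: is_sos_sqrM.
  + by rewrite mulrDr mulr_sumr; congr (_ + _); apply: eq_bigr => j _; rewrite mulrA.
Qed.

(** Links S(g) to the points delivered by [proper_qm_point]; the converse tests nonnegativity on g_j
    itself, a member of Q(g). *)
Lemma semialgP (x : 'I_n -> R) :
  semialg g x <-> forall p, QM g p -> 0 <= p.@[x].
Proof.
split=> [gx p /QMP [s0 [sj [h0 hj ->]]]|Hx j].
  rewrite mevalD; apply: addr_ge0; first exact: is_sos_meval_ge0.
  rewrite raddf_sum; apply: sumr_ge0 => j _ /=.
  by rewrite mevalM; apply: mulr_ge0; [exact: is_sos_meval_ge0 | exact: gx].
apply: Hx; apply/QMP; exists 0, (fun i => if i == j then 1 else 0); split.
- exact: is_sos0.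
- by move=> i; case: eqP => _; [rewrite -(expr1n P 2); apply: is_sos_sqr | exact: is_sos0].
- rewrite add0r (bigD1 j) //= eqxx mul1r big1 ?addr0 // => i /negPf ->.
  by rewrite mul0r.
Qed.

Lemma supp_QM_meval0 p x : supp_QM g p -> semialg g x -> p.@[x] = 0.
Proof.
move=> [Qp Qn] /semialgP H; apply/eqP; rewrite eq_le H // andbT.
by have := H _ Qn; rewrite mevalN oppr_ge0.
Qed.

Lemma QM_t_mono t t' p : (t <= t')%N -> QM_t g t p -> QM_t g t' p.
Proof.
move=> tt [s0 [sj [[h0 d0] [hj ->]]]]; exists s0, sj; split.
  by split=> //; apply: deg_le_trans d0.
split=> // j; have [sosj [sj0|dj]] := hj j; split=> //; first by left.
by right; apply: leq_trans dj tt.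
Qed.

Lemma QM_t_sos t p : is_sos p -> deg_le t p -> QM_t g t p.
Proof.
move=> sp dp; exists p, (fun _ => 0); split=> //; split=> [j|].
  by split; [exact: is_sos0 | left].
by rewrite big1 ?addr0 // => j _; rewrite mul0r.
Qed.

Lemma QM_t_sqrM t e p q : QM_t g t q -> deg_le e p -> QM_t g (t + 2 * e) (p ^+ 2 * q).
Proof.
move=> [s0 [sj [[h0 d0] [hj ->]]]] dp.
have dp2 : deg_le (2 * e) (p ^+ 2) by rewrite mulnC; apply: deg_leX.
exists (p ^+ 2 * s0), (fun j => p ^+ 2 * sj j); split.
  by split; [exact: is_sos_sqrM | rewrite addnC; apply: deg_leM].
split=> [j|].
  have [sosj dj] := hj j; split; first exact: is_sos_sqrM.
  case: dj => [->|dj]; first by left; rewrite mulr0.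
  have [->|p0] := eqVneq p 0; first by left; rewrite expr0n mul0r.
  right; move: dj; rewrite /mdeg_tot => dj.
  have dj' : deg_le (msize (sj j)).-1 (sj j) by rewrite /deg_le leqSpred.
  have := deg_leM dp2 dj'; rewrite /deg_le.
  move: (msize _) (msize _) (msize _) dj => a b c; lia.
by rewrite mulrDr mulr_sumr; congr (_ + _); apply: eq_bigr => j _; rewrite mulrA.
Qed.

End TruncatedModules.

(** * Vanishing of truncated functionals *)

Section TruncatedFunctionals.
Variables (R : realType) (n s : nat) (g : 'I_s -> {mpoly R[n]}).
Local Notation P := {mpoly R[n]}.
Implicit Types (p q h : P) (sigma : P -> R).

Lemma in_L0 t sigma : in_L g t sigma -> sigma 0 = 0.
Proof.
move=> [lin _]; have := lin 1 0 0 (deg_le0 _ _ _) (deg_le0 _ _ _).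
rewrite scale1r addr0 mul1r => /eqP; rewrite -[X in X == _]addr0.
by rewrite (inj_eq (addrI _)) => /eqP.
Qed.

Lemma in_LD t sigma p q : in_L g t sigma -> deg_le t p -> deg_le t q ->
  sigma (p + q) = sigma p + sigma q.
Proof. by move=> [lin _] dp dq; rewrite -[p]scale1r lin // mul1r scale1r. Qed.

Lemma in_LZ t sigma c p : in_L g t sigma -> deg_le t p -> sigma (c *: p) = c * sigma p.
Proof.
move=> L dp; have := L.1 c p 0 dp (deg_le0 _ _ _).
by rewrite addr0 (in_L0 L) addr0.
Qed.

Lemma in_LN t sigma p : in_L g t sigma -> deg_le t p -> sigma (- p) = - sigma p.
Proof. by move=> L dp; rewrite -scaleN1r (in_LZ _ L) // mulN1r. Qed.

Lemma in_L_sum t sigma (I : eqType) (r : seq I) (c : I -> R) (F : I -> P) :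
  in_L g t sigma -> (forall i, i \in r -> deg_le t (F i)) ->
  sigma (\sum_(i <- r) c i *: F i) = \sum_(i <- r) c i * sigma (F i).
Proof.
move=> L; elim: r => [|i r IH] dF; first by rewrite !big_nil (in_L0 L).
have dr j : j \in r -> deg_le t (F j) by move=> jr; apply: dF; rewrite inE jr orbT.
have di : deg_le t (F i) by apply: dF; rewrite inE eqxx.
rewrite !big_cons L.1 // ?IH // big_seq; elim/big_ind: _ => [||j jr].
- exact: deg_le0.
- by move=> ? ?; apply: deg_leD.
- by apply: deg_leZ; apply: dr.
Qed.

Lemma in_L_sqr_ge0 t sigma p : in_L g t sigma -> deg_le t (p ^+ 2) -> 0 <= sigma (p ^+ 2).
Proof. by move=> [_ pos] dp; apply: pos; apply: QM_t_sos => //; apply: is_sos_sqr. Qed.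

Lemma quadratic_ge0_linear_eq0 (a b : R) :
  (forall c, 0 <= c ^+ 2 * a + 2 * c * b) -> b = 0.
Proof.
move=> H.
have a0 : 0 <= a by have := H 1; have := H (-1); lra.
(* The denominator a + 1, unlike that of the minimiser -b/a, is positive even for a = 0. *)
pose c := - b / (a + 1).
have := H c; have -> : c ^+ 2 * a + 2 * c * b = - (b ^+ 2 * (a + 2) / (a + 1) ^+ 2).
  by rewrite /c; field; lra.
rewrite oppr_ge0 => Hb.
have {Hb} : b ^+ 2 * (a + 2) <= 0.
  by rewrite pmulr_lle0 ?invr_gt0 ?exprn_gt0 // in Hb; lra.
rewrite pmulr_lle0; last by lra.
by move=> b2; apply/eqP; rewrite -sqrf_eq0 eq_le b2 sqr_ge0.
Qed.

(** As sigma(q^2) = 0, the nonnegative sigma((c p + q)^2) is c^2 sigma(p^2) + 2 c sigma(p q) for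
    every real c. *)
Lemma in_L_cauchy_schwarz0 t sigma p q : in_L g t sigma ->
  deg_le t (p ^+ 2) -> deg_le t (p * q) -> deg_le t (q ^+ 2) ->
  sigma (q ^+ 2) = 0 -> sigma (p * q) = 0.
Proof.
move=> L dp dpq dq sq; apply: (@quadratic_ge0_linear_eq0 (sigma (p ^+ 2))) => c.
have E : (c *: p + q) ^+ 2 = c ^+ 2 *: p ^+ 2 + ((2 * c) *: (p * q) + q ^+ 2).
  by rewrite -!mul_mpolyC rmorphXn rmorphM /= mpolyC_nat; ring.
have d2 : deg_le t ((2 * c) *: (p * q) + q ^+ 2) by apply: deg_leD => //; apply: deg_leZ.
have : 0 <= sigma ((c *: p + q) ^+ 2).
  by apply: in_L_sqr_ge0 L _; rewrite E; apply: deg_leD => //; apply: deg_leZ.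
by rewrite E !L.1 // sq addr0.
Qed.

(* The functional sigma(p^2 .) vanishes on h^(2^N), and then by
   Cauchy-Schwarz on h^(2^j) for j = N-1, ..., 0. *)
Lemma supp_power_annihilates h N : supp_QM g (h ^+ (2 ^ N)) ->
  exists D, deg_le D h /\ forall t e p sigma, in_L g t sigma -> deg_le e p ->
    (D + 2 * e <= t)%N -> sigma (p ^+ 2 * h) = 0.
Proof.
move=> sh.
(* One more squaring makes the exponent even also for N = 0, so that the top power is itself a
   square. *)
have [_ [D0 QD0]] : supp_QM g (h ^+ (2 ^ N.+1)).
  have [_ [_ SM]] := is_ideal_supp_qm (quad_module_QM g).
  by rewrite expnS mul2n -addnn exprD; apply: SM sh.
pose D := (D0 + msize h * 2 ^ N.+1)%N.
have dh j : (j <= N.+1)%N -> deg_le D (h ^+ (2 ^ j)).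
  move=> jN; apply: deg_le_trans (deg_leX _ (deg_le_msize h)).
  by rewrite (leq_trans _ (leq_addl _ _)) // leq_mul2l leq_exp2l ?jN ?orbT.
exists D; split; first exact: (dh 0%N).
move=> t e p sigma L dp Dt.
have dp2 : deg_le (2 * e) (p ^+ 2) by rewrite mulnC; apply: deg_leX.
have dph j : (j <= N.+1)%N -> deg_le t (p ^+ 2 * h ^+ (2 ^ j)).
  move=> jN; apply: deg_le_trans (deg_leM dp2 (dh _ jN)).
  by rewrite addnC.
suff H k : (k <= N.+1)%N -> sigma (p ^+ 2 * h ^+ (2 ^ (N.+1 - k))) = 0.
  by have := H N.+1 (leqnn _); rewrite subnn expn0 expr1.
elim: k => [_|k IH kN]; rewrite ?subn0.
  apply/eqP; rewrite eq_le; apply/andP; split.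
    rewrite -oppr_ge0 -(in_LN L (dph _ (leqnn _))) -mulrN; apply: L.2.
    apply: QM_t_mono (QM_t_sqrM QD0 dp); apply: leq_trans Dt.
    by rewrite leq_add2r leq_addr.
  apply: L.2; apply: QM_t_sos; last exact: dph.
  by apply: is_sos_sqrM; rewrite expnSr exprM; apply: is_sos_sqr.
set j := (N.+1 - k.+1)%N.
have jE : (N.+1 - k)%N = j.+1 by rewrite /j; lia.
have jN : (j.+1 <= N.+1)%N by rewrite /j; lia.
have {}IH := IH (ltnW kN); rewrite jE in IH.
have E : p ^+ 2 * h ^+ (2 ^ j.+1) = (p * h ^+ (2 ^ j)) ^+ 2.
  by rewrite expnSr exprM exprMn.
rewrite expr2 -mulrA; apply: (in_L_cauchy_schwarz0 L).
- by apply: deg_le_trans dp2; apply: leq_trans Dt; apply: leq_addl.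
- by rewrite mulrA -expr2; apply: dph; apply: ltnW.
- by rewrite -E; apply: dph.
- by rewrite -E.
Qed.

(** The new variable joins the half of smaller or equal degree, and the halves exchange roles. *)
Lemma mnm_balanced_split (m : 'X_{1..n}) : exists a b : 'X_{1..n},
  [/\ m = (a + b)%MM, (mdeg b <= mdeg a)%N & (mdeg a <= (mdeg b).+1)%N].
Proof.
elim/mnm_ind: m => [|i m [a [b [-> ba ab]]]].
  by exists 0%MM, 0%MM; rewrite addm0.
exists (U_(i) + b)%MM, a; rewrite mdegD mdeg1 add1n.
by split=> //; apply/mnmP => j; rewrite !mnmDE; lia.
Qed.

(** Polarisation X^a X^b = ((X^a + X^b)/2)^2 - ((X^a - X^b)/2)^2 reduces to square multipliers;
    balanced halves keep the loss of degree independent of [m]. *)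
Lemma supp_power_annihilates_mnm h N : supp_QM g (h ^+ (2 ^ N)) ->
  exists D, forall t m sigma, in_L g t sigma -> (D + mdeg m <= t)%N ->
    sigma ('X_[m] * h) = 0.
Proof.
(* The successor absorbs the rounding 2 * mdeg a <= mdeg m + 1. *)
move=> /supp_power_annihilates [D [dh HD]]; exists D.+1 => t m sigma L Dt.
have [a [b [mE ba ab]]] := mnm_balanced_split m.
have da : deg_le (mdeg a) ('X_[a] : P) by apply: deg_le_mnm.
have db : deg_le (mdeg a) ('X_[b] : P) by apply: deg_le_trans (deg_le_mnm _ b).
have mm : mdeg m = (mdeg a + mdeg b)%N by rewrite mE mdegD.
have D2t : (D + 2 * mdeg a <= t)%N by lia.
pose u : P := 2^-1 *: ('X_[a] + 'X_[b]).
pose v : P := 2^-1 *: ('X_[a] - 'X_[b]).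
have du : deg_le (mdeg a) u by apply: deg_leZ; apply: deg_leD.
have dv : deg_le (mdeg a) v by apply: deg_leZ; apply: deg_leD => //; apply: deg_leN.
have E : 'X_[m] * h = u ^+ 2 * h - v ^+ 2 * h.
  have h2 : (2^-1)%:MP * 2%:R = 1 :> P.
    by rewrite -mpolyC_nat -mpolyCM mulVf ?pnatr_eq0 // mpolyC1.
  rewrite mE mpolyXD /u /v -!mul_mpolyC.
  transitivity (((2^-1)%:MP * 2%:R) ^+ 2 * ('X_[a] * 'X_[b] * h)); last by ring.
  by rewrite h2 expr1n mul1r.
have d2 w : deg_le (mdeg a) w -> deg_le t (w ^+ 2 * h).
  move=> dw; apply: deg_le_trans (deg_leM (deg_leX 2 dw) dh); lia.
rewrite E (in_LD L) ?(in_LN L) ?(HD t (mdeg a)) ?subrr //; try exact: d2.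
by apply: deg_leN; apply: d2.
Qed.

End TruncatedFunctionals.

(** * Powers of vanishing polynomials in the support *)

Section FinitePositivstellensatz.
Variables (R : realType) (n : nat).
Local Notation P := {mpoly R[n]}.
Local Notation "f .<[ x ]" := (horner_alg x f) (at level 2, format "f .<[ x ]").

Lemma meval_horner_alg (f : {poly R}) (x : P) (v : 'I_n -> R) :
  (f.<[x]).@[v] = f.[x.@[v]].
Proof.
elim/poly_ind: f => [|f c IH]; first by rewrite rmorph0 meval0 horner0.
by rewrite rmorphD rmorphM /= horner_algX horner_algC alg_mpolyC mevalD mevalM mevalC IH !hornerE.
Qed.

(* h is invertible modulo the support of the localisation Q_h. If Q_h were
   proper it would be nonnegative at some point, where h does not vanish,
   contradicting the hypothesis on h; hence -1 lies in Q_h. *)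
Lemma vanishing_power_in_supp (Q : P -> Prop) (h : P) : quad_module Q ->
  (forall a, exists N b, supp_qm Q (a ^+ N * (1 - a * b))) ->
  (forall v, (forall p, Q p -> 0 <= p.@[v]) -> h.@[v] = 0) ->
  exists N, supp_qm Q (h ^+ (2 ^ N)).
Proof.
move=> qQ reg van; have [S0 [SD SM]] := is_ideal_supp_qm qQ.
have qQh := quad_module_colon h qQ.
have sub : Defs.subpred Q (colon_qm Q h) by move=> p Qp; exists 0%N; rewrite muln0 mul1r.
have [[N QN]|nQh] := boolp.pselect (colon_qm Q h (-1)).
  (* Both h^(2N), a square, and its negative are in [Q]; as 2N < 2^(2N), the ideal property reaches
     the exponent 2^(2N). *)
  exists (2 * N)%N; rewrite -(subnK (ltnW (ltn_expl (2 * N) (isT : (1 < 2)%N)))) exprD.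
  apply: SM; split; last by rewrite -mulrN1.
  by rewrite mulnC exprM; apply: quad_module_sqr.
have [|v vP] := proper_qm_point qQh nQh.
  move=> i; have [f f0 [sf sf']] := exists_univariate_relation (is_ideal_supp_qm qQ) reg 'X_i.
  by exists f => //; split; apply: sub.
have hv : h.@[v] = 0 by apply: van => p /sub; apply: vP.
(* Regularity puts -(1 - h b) into Q_h, yet its value at [v] is -1. *)
have [N [b sb]] := reg h.
have [s1 s2] : supp_qm Q (h ^+ (2 * N) * (1 - h * b)).
  by rewrite mul2n -addnn exprD -mulrA; apply: SM.
have : 0 <= (- (1 - h * b)).@[v] by apply: vP; exists N; rewrite mulrN.
by rewrite mevalN mevalB meval1 mevalM hv mul0r subr0 lerNr oppr0 leNgt ltr01.
Qed.

End FinitePositivstellensatz.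

(** * Finite point sets, interpolation and truncation *)

Section FinitePointSets.
Variables (R : realType) (n : nat).
Local Notation P := {mpoly R[n]}.

Lemma poly_roots_seq (f : {poly R}) : f != 0 ->
  exists t : seq R, forall c, root f c -> c \in t.
Proof.
move=> f0; apply: (@bounded_card_seq _ (root f) (size f)) => t ut rt.
by apply: max_poly_roots => //; apply/allP.
Qed.

(** The points of [S] lie on the finite grid given by the lists t_i. Finite functions index the
    grid, since they can be listed and compared. *)
Lemma enumerate_points (S : ('I_n -> R) -> Prop) (t : 'I_n -> seq R) :
  (forall v, S v -> forall i, v i \in t i) ->
  exists (r : nat) (xi : 'I_r -> 'I_n -> R),
    injective xi /\ forall v, S v <-> exists i, v = xi i.
Proof.
move=> St.
pose N := \max_i size (t i).
pose cand (F : {ffun 'I_n -> 'I_N}) : {ffun 'I_n -> R} := [ffun i => (t i)`_(F i)].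
pose L := undup [seq x <- [seq cand F | F <- enum {: {ffun 'I_n -> 'I_N}}]
                | boolp.asbool (S (x : {ffun 'I_n -> R}))].
exists (size L), (fun i => nth [ffun=> 0] L i); split.
  move=> i j /= eij; apply/val_inj/eqP; 
  rewrite -(nth_uniq [ffun=> 0] (ltn_ord i) (ltn_ord j) (undup_uniq _)).
  by apply/eqP/ffunP => k; rewrite eij.
move=> v; split=> [Sv|[i ->]]; last first.
  have : nth [ffun=> 0] L i \in L by apply: mem_nth.
  by rewrite mem_undup mem_filter => /andP [/boolp.asboolP].
have iN i : (index (v i) (t i) < N)%N.
  by apply: leq_trans (leq_bigmax i); rewrite index_mem; apply: St.
pose F : {ffun 'I_n -> 'I_N} := [ffun i => Ordinal (iN i)].
have vE : v = cand F.
  by apply: boolp.funext => i; rewrite !ffunE /= nth_index //; apply: St.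
have FL : cand F \in L.
  rewrite mem_undup mem_filter; apply/andP; split; first by apply/boolp.asboolP; rewrite -vE.
  by apply: map_f; rewrite mem_enum.
have iL : (index (cand F) L < size L)%N by rewrite index_mem.
by exists (Ordinal iL); rewrite /= nth_index.
Qed.

Variables (r : nat) (xi : 'I_r -> 'I_n -> R).

(** Lagrange interpolation: u_i is a product of affine polynomials, each in a coordinate separating
    xi_i from xi_j. *)
Lemma exists_interp_deg : injective xi -> exists t, interp_deg xi t.
Proof.
move=> xiI.
have /boolp.choice [q qP] : forall ij : 'I_r * 'I_r, exists q : P,
    ij.1 != ij.2 -> q.@[xi ij.1] = 1 /\ q.@[xi ij.2] = 0.
  move=> [i j] /=; have [eij|ij] := eqVneq i j; first by exists 0.
  have [l xl] : exists l, xi i l != xi j l.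
    apply: boolp.contrapT => nex; case/eqP: ij; apply: xiI; apply: boolp.funext => l.
    by apply/eqP/negPn/negP => xl; apply: nex; exists l.
  exists ((xi i l - xi j l)^-1 *: ('X_l - (xi j l)%:MP)) => _.
  by rewrite !mevalZ !mevalB !mevalXU !mevalC subrr mulr0 mulVf ?subr_eq0.
pose u i := \prod_(j | j != i) q (i, j).
exists (\max_i msize (u i)) => c; exists (\sum_i c i *: u i); split.
  apply: deg_le_sum => i; apply: deg_leZ; apply: deg_le_trans (deg_le_msize _).
  exact: leq_bigmax.
move=> i; rewrite raddf_sum (bigD1 i) //= big1 ?addr0 => [|j ji].
  rewrite mevalZ rmorph_prod big1 ?mulr1 //= => j ji.
  by have [|-> _] := qP (i, j); rewrite //= eq_sym.
rewrite mevalZ rmorph_prod (bigD1 i) /=; last by rewrite eq_sym.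
by have [|_ ->] := qP (j, i); rewrite //= ?mul0r ?mulr0.
Qed.

Lemma exists_regularity : injective xi -> exists rho, is_regularity xi rho.
Proof.
move=> /exists_interp_deg [t0 It0].
have ex : exists t, boolp.asbool (interp_deg xi t) by exists t0; apply/boolp.asboolP.
case: (ex_minnP ex) => t /boolp.asboolP It tmin.
by exists t.+1; split=> //; split=> // t' It'; apply: tmin; apply/boolp.asboolP.
Qed.

Variables (s : nat) (g : 'I_s -> P).

(* The polynomials 1 - sum_i u_i and (X_l - xi_il) u_i, with u_i interpolating,
   generate the vanishing ideal with degree control: killing their monomial
   multiples forces sigma = sum_i sigma(u_i) e_xi_i. *)
Lemma in_L_truncation (rho1 : nat) : interp_deg xi rho1 ->
  (forall h : P, (forall i, h.@[xi i] = 0) -> exists N, supp_QM g (h ^+ (2 ^ N))) ->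
  exists d, (2 * rho1 <= d)%N /\ forall k sigma, in_L g (d + k) sigma ->
    exists tau, in_cone_eval xi tau /\
      forall p, deg_le (2 * rho1 + k) p -> sigma p = tau p.
Proof.
move=> itp van.
have /boolp.choice [u uP] : forall i : 'I_r, exists u : P, deg_le rho1 u /\
    forall j, u.@[xi j] = (j == i)%:R by move=> i; apply: itp.
have ud i : deg_le rho1 (u i) by case: (uP i).
have uE i j : (u i).@[xi j] = (j == i)%:R by case: (uP i).
have kill h : (forall i, h.@[xi i] = 0) -> exists D, forall t m sigma,
    in_L g t sigma -> (D + mdeg m <= t)%N -> sigma ('X_[m] * h) = 0.
  by move=> /van [N]; apply: supp_power_annihilates_mnm.
have [|D0 D0P] := kill (1 - \sum_i u i).
  move=> j; rewrite mevalB meval1 [(\sum_i u i).@[_]]raddf_sum (bigD1 j) //= uE eqxx big1 ?addr0 ?subrr //.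
  by move=> i ij; rewrite uE eq_sym (negPf ij).
have /boolp.choice [D1 D1P] : forall il : 'I_r * 'I_n, exists D, forall t m sigma,
    in_L g t sigma -> (D + mdeg m <= t)%N ->
    sigma ('X_[m] * (('X_(il.2) - (xi il.1 il.2)%:MP) * u il.1)) = 0.
  move=> [i l]; apply: kill => j /=; rewrite mevalM mevalB mevalXU mevalC uE.
  by case: eqP => [->|_]; rewrite ?subrr ?mul0r ?mulr0.
pose D := (D0 + \sum_il D1 il)%N.
have D1D il : (D1 il <= D)%N by rewrite /D (bigD1 il) //= addnCA leq_addr.
(* Multipliers have degree up to 2 rho1 + k, and a factor u_i adds rho1; [D] covers every loss of
   degree. *)
exists (D + 3 * rho1)%N; split; first lia.
move=> k sigma; set t := (D + 3 * rho1 + k)%N => L.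
have dXu m i : (mdeg m <= 2 * rho1 + k)%N -> deg_le t ('X_[m] * u i).
  by move=> dm; apply: deg_le_trans (deg_leM (deg_le_mnm _ m) (ud i)); rewrite /t; lia.
have dX m : (mdeg m <= 2 * rho1 + k)%N -> deg_le t ('X_[m] : P).
  by move=> dm; apply: deg_le_trans (deg_le_mnm _ m); rewrite /t; lia.
(* Since (X_l - xi_il) u_i is killed, each variable in front of u_i may be replaced by its value at
   xi_i. *)
have sXu i m : (mdeg m <= 2 * rho1 + k)%N ->
    sigma ('X_[m] * u i) = 'X_[m].@[xi i] * sigma (u i).
  elim/mnm_ind: m => [_|l m IH]; first by rewrite mpolyX0 meval1 !mul1r.
  rewrite mdegD mdeg1 => dm.
  have E : 'X_[U_(l) + m] * u i =
      xi i l *: ('X_[m] * u i) + 'X_[m] * (('X_l - (xi i l)%:MP) * u i).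
    by rewrite mpolyXD -mul_mpolyC; ring.
  have dE : deg_le t ('X_[m] * (('X_l - (xi i l)%:MP) * u i)).
    have -> : 'X_[m] * (('X_l - (xi i l)%:MP) * u i) =
        'X_[U_(l) + m] * u i + - (xi i l *: ('X_[m] * u i)) by rewrite E addrAC subrr add0r.
    apply: deg_leD; first by apply: dXu; rewrite mdegD mdeg1.
    by apply/deg_leN/deg_leZ/dXu; lia.
  rewrite E L.1 // ?(D1P (i, l) t) // ?addr0.
  - rewrite IH; last by lia.
    by rewrite mpolyXD mevalM mevalXU mulrA.
  - by have := D1D (i, l); rewrite /t; lia.
  - by apply: dXu; lia.
have sX m : (mdeg m <= 2 * rho1 + k)%N ->
    sigma 'X_[m] = \sum_i sigma (u i) * 'X_[m].@[xi i].
  move=> dm.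
  have E : 'X_[m] = \sum_i 1 *: ('X_[m] * u i) + 'X_[m] * (1 - \sum_i u i) :> P.
    under eq_bigr do rewrite scale1r.
    by rewrite -mulr_sumr; ring.
  have dS : deg_le t (\sum_i 1 *: ('X_[m] * u i)).
    by apply: deg_le_sum => i; apply/deg_leZ/dXu.
  have dE : deg_le t ('X_[m] * (1 - \sum_i u i)).
    have -> : 'X_[m] * (1 - \sum_i u i) = 'X_[m] + - (\sum_i 1 *: ('X_[m] * u i)) :> P.
      by rewrite {2}E addrAC subrr add0r.
    by apply: deg_leD; [exact: dX | exact: deg_leN].
  rewrite {1}E (in_LD L) // (D0P t) //; last by rewrite /t /D; lia.
  rewrite addr0 (in_L_sum _ L) => [|i _]; last exact: dXu.
  by apply: eq_bigr => i _; rewrite mul1r sXu // mulrC.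
have sp p : deg_le (2 * rho1 + k) p -> sigma p = \sum_i sigma (u i) * p.@[xi i].
  move=> dp.
  have dm m : m \in msupp p -> (mdeg m <= 2 * rho1 + k)%N.
    by move=> /msize_mdeg_lt mp; rewrite -ltnS (leq_trans mp).
  rewrite {1}(mpolyE p) (in_L_sum _ L) => [|m mp]; last by apply/dX/dm.
  rewrite big_seq; under eq_bigr => m mp do rewrite sX ?dm // mulr_sumr.
  rewrite -big_seq exchange_big /=; apply: eq_bigr => i _.
  rewrite {3}(mpolyE p) raddf_sum mulr_sumr; apply: eq_bigr => m _ /=.
  by rewrite mevalZ mulrCA.
exists (fun p => \sum_i sigma (u i) * p.@[xi i]); split=> //.
exists (fun i => sigma (u i)); split=> // i.
have du2 : deg_le (2 * rho1) (u i ^+ 2) by rewrite mulnC; apply: deg_leX.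
(* u_i^2 and u_i agree at all points; the range 2 rho1 + k is large enough to contain u_i^2. *)
have -> : sigma (u i) = sigma (u i ^+ 2).
  rewrite (sp (u i ^+ 2)); last by apply: deg_le_trans du2; rewrite leq_addr.
  rewrite (bigD1 i) //= big1 ?addr0 => [|j ji]; rewrite rmorphXn /= uE.
    by rewrite eqxx expr1n mulr1.
  by rewrite (negPf ji) expr0n mulr0.
by apply: (in_L_sqr_ge0 L); apply: deg_le_trans du2; rewrite /t; lia.
Qed.

Lemma in_L_cone_eval t tau : (forall i, semialg g (xi i)) ->
  in_cone_eval xi tau -> in_L g t tau.
Proof.
move=> gxi [lam [lam0 tauE]]; split=> [a p q _ _|q Qq].
  rewrite !tauE mulr_sumr -big_split; apply: eq_bigr => i _ /=.
  by rewrite mevalD mevalZ mulrDr mulrCA.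
rewrite tauE; apply: sumr_ge0 => i _; apply: mulr_ge0 => //.
by have /semialgP := gxi i; apply; exists t.
Qed.

End FinitePointSets.

(** * Finiteness of S(g) and equality of the truncated cones *)

Unset Implicit Arguments.

Theorem mainTheorem4 (R : realType) (n s : nat) (g : 'I_s -> {mpoly R[n]}) :
  krull_dim_quot_eq0 (supp_QM g) ->
  exists (r : nat) (xi : 'I_r -> 'I_n -> R),
    (0 < r)%N /\ injective xi /\
    (forall x : 'I_n -> R, semialg g x <-> exists i, x = xi i) /\
    exists rho : nat, is_regularity xi rho /\
    exists d : nat, (2 * rho.-1 <= d)%N /\
      forall k : nat,
        restr_eq (2 * rho.-1 + k)%N (in_L g (d + k)%N) (in_cone_eval xi).
Proof.
move=> dim0.
have qQ := quad_module_QM g; have idJ := is_ideal_supp_qm qQ.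
have reg := krull_dim0_strongly_regular idJ dim0.
have /boolp.choice [t tP] : forall l : 'I_n, exists t : seq R,
    forall v, semialg g v -> v l \in t.
  (* f(X_l) in the support vanishes on S(g), so l-th coordinates are roots of [f]. *)
  move=> l; have [f f0 sf] := exists_univariate_relation idJ reg 'X_l.
  have [t tP] := poly_roots_seq f0; exists t => v gv; apply: tP.
  by rewrite rootE -(mevalXU v l) -meval_horner_alg (supp_QM_meval0 sf gv).
have [|r [xi [xiI xiP]]] := @enumerate_points R n (semialg g) t.
  by move=> v gv l; apply: tP.
have gxi i : semialg g (xi i) by apply/xiP; exists i.
have van h : (forall i, h.@[xi i] = 0) -> exists N, supp_QM g (h ^+ (2 ^ N)).
  move=> hxi; apply: (vanishing_power_in_supp qQ reg) => v /semialgP /xiP [i ->].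
  exact: hxi.
have [rho rhoP] := exists_regularity xiI.
exists r, xi; split.
  (* Were S(g) empty, 1 would vanish on it and lie in the support, hence in the prime ideal provided
     by dimension 0. *)
  rewrite lt0n; apply/eqP => r0.
  have [|N] := van 1; first by move=> i; have := ltn_ord i; rewrite [X in (_ < X)%N -> _]r0.
  rewrite expr1n => s1; have [[I [[_ [I1 _]] JI]] _] := dim0.
  by apply: I1; apply: JI.
split=> //; split=> //; exists rho; split=> //.
have [d [rd dP]] := in_L_truncation rhoP.2.1 van.
exists d; split=> // k; split=> [sigma /dP //|tau taucone].
by exists tau; split=> //; apply: in_L_cone_eval taucone.
Qed.
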